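(* Let $\mathbb{F}$ be any field, $d,s$ positive integers, and let $\mathcal{P}$ be a set of $n$ points in $\mathbb{F}^d$. If the unit distance graph of $\mathcal{P}$ contains no copy of $K_{s,s}$, then the number of unit distances spanned by $\mathcal{P}$ is at most $C\, n^{2-\frac{1}{\lceil d/2\rceil+1}}$, where $C$ depends only on $d$ and $s$.
   Context: The unit sphere in $\mathbb{F}^d$ with center $a=(a_1,\dots,a_d)$ is the set of $x\in\mathbb{F}^d$ with $(x_1-a_1)^2+\dots+(x_d-a_d)^2=1$. Points $a,b$ are at unit distance if $b$ lies on the unit sphere with center $a$. The unit distance graph of $\mathcal{P}$ has vertex set $\mathcal{P}$ and an edge between any two points at unit distance; the number of unit distances spanned by $\mathcal{P}$ is the number of such pairs. *)

(* Defs.v *)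
From mathcomp Require Import all_boot all_order all_algebra finmap.

Set Implicit Arguments.
Unset Strict Implicit.
Unset Printing Implicit Defensive.

Import GRing.Theory.
Local Open Scope ring_scope.

Definition unit_sphere (F : fieldType) (d : nat) (a : 'rV[F]_d) :
    pred 'rV[F]_d :=
  [pred x : 'rV[F]_d | \sum_(i < d) (x 0 i - a 0 i) ^+ 2 == 1].

Definition unit_dist (F : fieldType) (d : nat) : rel 'rV[F]_d :=
  [rel a b | b \in unit_sphere a].

(* The vertex type is P itself, coerced to the finite type of its elements.
   The relation is symmetric, and irreflexive because 0 != 1 in a field. *)
Definition unit_distance_graph (F : fieldType) (d : nat)
    (P : {fset 'rV[F]_d}) : rel P :=
  [rel a b : P | unit_dist (val a) (val b)].
Arguments unit_distance_graph {F d} P.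

(* Edges are unordered pairs of adjacent vertices. *)
Definition edges (T : finType) (e : rel T) : {set {set T}} :=
  [set [set p.1; p.2] | p : T * T & e p.1 p.2].

Definition num_unit_distances (F : fieldType) (d : nat)
    (P : {fset 'rV[F]_d}) : nat :=
  #|edges (unit_distance_graph P)|.

(* K_{s,t} as a subgraph, not necessarily induced. *)
Definition contains_biclique (T : finType) (e : rel T) (s t : nat) : Prop :=
  exists A B : {set T},
    [/\ #|A| = s, #|B| = t, [disjoint A & B]
      & forall a b, a \in A -> b \in B -> e a b].

(* Main.v *)
(** Put k = uphalf d + 1.  Expanding the square writes "x and y are at unit
    distance" as an orthogonality <u(x), v(y)> = 0 in F^(d+2), and d + 2 <= 2k.
    Let H count the pairs of k-tuples (x, y) spanning a complete bipartite
    pattern.  If u(x) and v(y) are both free families, the span of u(x) is the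
    whole orthogonal of v(y), so every common neighbour of y is adjacent to
    every common neighbour of x; without K_{s,s} one of these two sets has fewer
    than s elements.  If x_i depends on the other entries, then it is adjacent to
    all of their common neighbours, which leaves fewer than s choices for x_i as
    soon as there are s of them.  So, G counting the patterns with one entry of x
    dropped, H <= 2 (s^k n^k + k s G), while 4 k s G <= (4 k s)^k n^k + H
    termwise, whence H = O(n^k).  Two applications of the power mean inequality
    bound H below by E^(k^2) / n^(2k(k-1)), where E is the number of adjacent
    ordered pairs. *)

Require Import Defs.
From mathcomp Require Import all_boot all_order all_algebra finmap.
From mathcomp Require Import reals exp.
From mathcomp Require Import zify.

Set Implicit Arguments.
Unset Strict Implicit.
Unset Printing Implicit Defensive.

Import Order.TTheory GRing.Theory Num.Theory.

Local Open Scope nat_scope.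

(** * Power mean inequality over the natural numbers *)

Lemma leq_rearrangement_exp (a b m : nat) :
  a * b ^ m + b * a ^ m <= a ^ m.+1 + b ^ m.+1.
Proof.
wlog le_ab : a b / a <= b.
  by move=> W; have [/W//|/ltnW/W] := leqP a b; rewrite addnC [X in _ <= X]addnC.
case: m => [|m]; first by rewrite !expn0 !expn1 !muln1.
have : a ^ m.+1 <= b ^ m.+1 by rewrite leq_exp2r.
rewrite ![_ ^ m.+2]expnS; nia.
Qed.

(** Twice the inequality is the sum of [leq_rearrangement_exp] over all pairs [(a i, a j)]. *)
Lemma leq_chebyshev_exp (I : finType) (a : I -> nat) (m : nat) :
  (\sum_i a i) * (\sum_i a i ^ m) <= #|I| * \sum_i a i ^ m.+1.
Proof.
rewrite -(leq_pmul2l (isT : 0 < 2)) !mul2n -!addnn.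
rewrite {2}[_ * (\sum_i a i ^ m)]mulnC.
have E1 : (\sum_i a i) * (\sum_i a i ^ m) = \sum_i \sum_j a i * a j ^ m.
  by rewrite big_distrl; apply: eq_bigr => i _; rewrite big_distrr.
have E2 : (\sum_i a i ^ m) * (\sum_i a i) = \sum_i \sum_j a j * a i ^ m.
  rewrite big_distrl; apply: eq_bigr => i _; rewrite big_distrr.
  by apply: eq_bigr => j _; rewrite mulnC.
have E3 : #|I| * \sum_i a i ^ m.+1 = \sum_(i : I) \sum_j a j ^ m.+1.
  by rewrite sum_nat_const.
have E4 : #|I| * \sum_i a i ^ m.+1 = \sum_i \sum_(j : I) a i ^ m.+1.
  by rewrite E3 exchange_big.
rewrite E1 E2 {1}E4 E3 -!big_split; apply: leq_sum => i _ /=.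
rewrite -!big_split; apply: leq_sum => j _ /=.
exact: leq_rearrangement_exp.
Qed.

Lemma leq_power_mean (I : finType) (a : I -> nat) (m : nat) :
  (\sum_i a i) ^ m.+1 <= #|I| ^ m * \sum_i a i ^ m.+1.
Proof.
elim: m => [|m IHm]; first by rewrite mul1n.
rewrite expnS; apply: (leq_trans (leq_mul (leqnn _) IHm)).
by rewrite mulnCA expnSr -mulnA leq_mul2l leq_chebyshev_exp orbT.
Qed.

(** * Double counting of complete bipartite patterns of tuples *)

Section CompleteTuples.

Variables (T : finType) (e : rel T).
Hypothesis e_sym : symmetric e.

Definition common_nbrs (I : finType) (x : {ffun I -> T}) : {set T} :=
  [set z | [forall i, e (x i) z]].

Definition complete_pairs (I J : finType) :
    {set {ffun I -> T} * {ffun J -> T}} :=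
  [set p : {ffun I -> T} * {ffun J -> T} |
    [forall i, forall j, e (p.1 i) (p.2 j)]].

Lemma in_common_nbrs (I : finType) (x : {ffun I -> T}) z :
  reflect (forall i, e (x i) z) (z \in common_nbrs x).
Proof. by rewrite inE; apply: forallP. Qed.

Lemma in_complete_pairs (I J : finType) (x : {ffun I -> T}) (y : {ffun J -> T}) :
  reflect (forall i j, e (x i) (y j)) ((x, y) \in complete_pairs I J).
Proof.
rewrite inE /=; apply: (iffP forallP) => [h i j|h i]; first by move/forallP: (h i).
by apply/forallP.
Qed.

(** For a fixed [x], the admissible [y] are exactly the functions from [J] into the common
    neighbours of [x]. *)
Lemma card_complete_pairs_in (I J : finType) (P : pred {ffun I -> T}) :
  #|[set p in complete_pairs I J | P p.1]|
    = \sum_(x | P x) #|common_nbrs x| ^ #|J|.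
Proof.
rewrite -sum1_card.
rewrite (eq_bigl (fun p => P p.1 && ((p.1, p.2) \in complete_pairs I J))); last first.
  by move=> [x y]; rewrite inE andbC.
rewrite -(pair_big_dep P (fun x y => (x, y) \in complete_pairs I J) (fun _ _ => 1)) /=.
apply: eq_bigr => x _; rewrite sum1_card -card_ffun_on.
apply: eq_card => y; apply/in_complete_pairs/ffun_onP => [h j|h i j].
  by apply/in_common_nbrs => i.
by move/in_common_nbrs: (h j).
Qed.

Lemma card_complete_pairs (I J : finType) :
  #|complete_pairs I J| = \sum_(x : {ffun I -> T}) #|common_nbrs x| ^ #|J|.
Proof.
by rewrite -card_complete_pairs_in; apply: eq_card => p; rewrite !inE andbT.
Qed.

Lemma complete_pairs_swap (I J : finType) (x : {ffun I -> T}) (y : {ffun J -> T}) :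
  ((x, y) \in complete_pairs I J) = ((y, x) \in complete_pairs J I).
Proof.
by apply/in_complete_pairs/in_complete_pairs => h i j; rewrite e_sym.
Qed.

Lemma card_complete_pairs_swap (I J : finType)
    (P : pred ({ffun I -> T} * {ffun J -> T})) :
  #|[set p in complete_pairs I J | P p]|
    = #|[set p in complete_pairs J I | P (p.2, p.1)]|.
Proof.
have sw_inj : injective (fun p : {ffun I -> T} * {ffun J -> T} => (p.2, p.1)).
  by move=> [x y] [x' y'] [-> ->].
rewrite -(card_imset _ sw_inj); apply: eq_card => -[y x].
apply/imsetP/idP => [[[x' y'] + [-> ->]]|]; rewrite inE /= => /andP[h1 h2].
  by rewrite inE /= -complete_pairs_swap h1.
by exists (x, y) => //; rewrite inE complete_pairs_swap h1.
Qed.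

Lemma card_complete_pairsC (I J : finType) :
  #|complete_pairs I J| = #|complete_pairs J I|.
Proof.
rewrite -[LHS](eq_card (_ : [set p in complete_pairs I J | true] =i _)); last first.
  by move=> p; rewrite in_set andbT.
by rewrite card_complete_pairs_swap; apply: eq_card => p; rewrite in_set andbT.
Qed.

(** The first power mean bounds the number of stars with [m.+1] leaves from below by the degrees;
    the second starts from the same number, now summed over the tuples of leaves. *)
Lemma leq_card_complete_pairs (m : nat) :
  (\sum_(y : T) #|[set z | e y z]|) ^ (m.+1 * m.+1)
    <= #|T| ^ (2 * (m.+1 * m)) * #|complete_pairs 'I_m.+1 'I_m.+1|.
Proof.
pose E := \sum_(x : {ffun 'I_m.+1 -> T}) #|common_nbrs x|.
have E_stars : \sum_(y : T) #|[set z | e y z]| ^ m.+1 = E.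
  (* A star is a complete pair whose first tuple has a single entry, so exchanging the two sides
     passes from centres to leaves. *)
  transitivity #|complete_pairs 'I_1 'I_m.+1|.
    rewrite card_complete_pairs card_ord.
    rewrite (reindex (fun y : T => [ffun _ : 'I_1 => y])) /=; last first.
      exists (fun f : {ffun 'I_1 -> T} => f ord0) => [y _|f _]; first by rewrite ffunE.
      by apply/ffunP => i; rewrite ffunE (ord1 i).
    apply: eq_bigr => y _; congr (_ ^ _); apply: eq_card => z.
    rewrite inE; apply/idP/in_common_nbrs => [h i|/(_ ord0)]; by rewrite ffunE.
  rewrite card_complete_pairsC card_complete_pairs card_ord.
  by apply: eq_bigr => x _; rewrite expn1.
have h1 := leq_power_mean (fun y : T => #|[set z | e y z]|) m.
rewrite E_stars in h1.
have h2 := leq_power_mean (fun x : {ffun 'I_m.+1 -> T} => #|common_nbrs x|) m.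
have := card_complete_pairs 'I_m.+1 'I_m.+1; rewrite card_ord => EH.
rewrite -EH card_ffun card_ord -expnM -/E in h2.
rewrite expnM; apply: (@leq_trans ((#|T| ^ m * E) ^ m.+1)); first by rewrite leq_exp2r.
rewrite expnMn -expnM mul2n -addnn expnD -mulnA [m * _]mulnC.
by rewrite leq_mul2l h2 orbT.
Qed.

End CompleteTuples.

(** * Few degenerate tuples in a graph without K_{s,s} *)

Section NoBiclique.

Variables (T : finType) (e : rel T) (s : nat).
Hypotheses (e_sym : symmetric e) (e_irr : irreflexive e).
Hypothesis no_biclique : ~ contains_biclique e s s.

Local Notation common_nbrs := (common_nbrs e).
Local Notation complete_pairs := (complete_pairs e).

(** Otherwise subsets of size exactly [s] would form a biclique; they are disjoint because no vertex
    is adjacent to itself. *)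
Lemma complete_sets_small (A B : {set T}) :
  (forall a b, a \in A -> b \in B -> e a b) -> s <= #|A| -> #|B| < s.
Proof.
move=> cAB /card_geqP[l [ul sl lA]]; rewrite ltnNge; apply/negP.
move=> /card_geqP[l' [ul' sl' lB]]; apply: no_biclique.
exists [set z in l], [set z in l']; split.
- by rewrite cardsE -sl; apply/card_uniqP.
- by rewrite cardsE -sl'; apply/card_uniqP.
- rewrite -setI_eq0; apply/eqP/setP => z; rewrite !inE.
  apply/negP => /andP[/lA zA /lB zB].
  by have := cAB _ _ zA zB; rewrite e_irr.
- by move=> a b; rewrite !inE => /lA aA /lB; apply: cAB.
Qed.

Definition drop_coord (m : nat) (i : 'I_m.+1) (x : {ffun 'I_m.+1 -> T}) :
    {ffun 'I_m -> T} := [ffun j => x (lift i j)].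

(** A stand-in for linear dependence of [x i] on the other entries, phrased by neighbourhoods so
    that the counting involves no vectors. *)
Definition redundant (m : nat) (x : {ffun 'I_m.+1 -> T}) (i : 'I_m.+1) : bool :=
  common_nbrs (drop_coord i x) \subset [set z | e (x i) z].

Definition degenerate (m : nat) (x : {ffun 'I_m.+1 -> T}) : bool :=
  (#|common_nbrs x| < s) || [exists i, redundant x i].

Lemma common_nbrs_redundant (m : nat) (x : {ffun 'I_m.+1 -> T}) i :
  redundant x i -> common_nbrs x = common_nbrs (drop_coord i x).
Proof.
move=> /subsetP h; apply/setP => z.
apply/in_common_nbrs/in_common_nbrs => [hz j|hz j]; first by rewrite ffunE.
case: (unliftP i j) => [j' ->|->]; first by have := hz j'; rewrite ffunE.
by have := h z; rewrite inE; apply; apply/in_common_nbrs.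
Qed.

(** Group the tuples by what remains after dropping entry [i]. Redundancy makes the summand constant
    on each group, so it suffices that a group has at most [s] members. *)
Lemma sum_redundant (m k : nat) (i : 'I_m.+1) :
  \sum_(x : {ffun 'I_m.+1 -> T} | (s <= #|common_nbrs x|) && redundant x i)
      #|common_nbrs x| ^ k
    <= s * \sum_(x : {ffun 'I_m -> T}) #|common_nbrs x| ^ k.
Proof.
rewrite (partition_big (@drop_coord m i) xpredT) //= big_distrr /=.
apply: leq_sum => x' _.
rewrite (eq_bigr (fun=> #|common_nbrs x'| ^ k)); last first.
  by move=> x /andP[/andP[_ /common_nbrs_redundant ->] /eqP ->].
rewrite sum_nat_const leq_mul2r; apply/orP; right.
set Q := (X in #|X| <= s).
have [|lt] := leqP s #|common_nbrs x'|; last first.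
  rewrite eq_card0 // => x; apply/negP.
  move=> /andP[/andP[sx /common_nbrs_redundant xE] /eqP x'E].
  by move: sx; rewrite xE x'E leqNgt lt.
(* [Z] contains every possible dropped entry and is completely joined to the common neighbours of
   [x'], of which there are at least [s]. *)
pose Z := [set z | common_nbrs x' \subset [set w | e z w]] => sx'.
apply: (@leq_trans #|Z|); last first.
  apply/ltnW/(complete_sets_small _ sx') => w z wx'; rewrite inE => /subsetP/(_ _ wx').
  by rewrite inE e_sym.
have inj : {in Q &, injective (fun x : {ffun 'I_m.+1 -> T} => x i)}.
  move=> x y /andP[_ /eqP hx] /andP[_ /eqP hy] xy; apply/ffunP => j.
  case: (unliftP i j) => [j' ->|-> //].
  by move/ffunP: hx => /(_ j'); move/ffunP: hy => /(_ j'); rewrite !ffunE => -> ->.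
rewrite -(card_in_imset inj); apply: subset_leq_card; apply/subsetP => z.
by case/imsetP => x /andP[/andP[_ h] /eqP hx] ->; rewrite inE -hx.
Qed.

Lemma sum_degenerate (m k : nat) :
  \sum_(x : {ffun 'I_m.+1 -> T} | degenerate x) #|common_nbrs x| ^ k
    <= s ^ k * #|T| ^ m.+1
       + m.+1 * s * \sum_(x : {ffun 'I_m -> T}) #|common_nbrs x| ^ k.
Proof.
apply: (@leq_trans (\sum_(x : {ffun 'I_m.+1 -> T})
  (s ^ k + \sum_(i | (s <= #|common_nbrs x|) && redundant x i)
             #|common_nbrs x| ^ k))).
  rewrite big_mkcond; apply: leq_sum => x _; rewrite /degenerate.
  have [lt|ge] /= := ltnP.
    rewrite (leq_trans _ (leq_addr _ _)) //.
    by case: (k) => // k'; rewrite leq_exp2r // ltnW.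
  case: existsP => // -[i hi]; rewrite (bigD1 i) //=; lia.
rewrite big_split sum_nat_const card_ffun card_ord mulnC leq_add2l /=.
rewrite (exchange_big_dep xpredT) //= -mulnA.
rewrite -[X in X * _](card_ord m.+1) -sum_nat_const.
by apply: leq_sum => i _; apply: sum_redundant.
Qed.

Lemma card_complete_pairs_degenerate (m : nat) :
  (forall x y : {ffun 'I_m.+1 -> T}, (x, y) \in complete_pairs 'I_m.+1 'I_m.+1 ->
     degenerate x || degenerate y) ->
  #|complete_pairs 'I_m.+1 'I_m.+1|
    <= (4 * s ^ m.+1 + (4 * m.+1 * s) ^ m.+1) * #|T| ^ m.+1.
Proof.
move=> deg.
(* The factor 4 lets [H] be absorbed: doubling [HB] and [BG] leaves the term [L * G], which [LG]
   bounds with only one copy of [H]. *)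
set H := #|_|; pose L := 4 * m.+1 * s.
pose B := \sum_(x : {ffun 'I_m.+1 -> T} | degenerate x) #|common_nbrs x| ^ m.+1.
pose G := \sum_(x : {ffun 'I_m -> T}) #|common_nbrs x| ^ m.+1.
have HB : H <= B + B.
  have card_left := card_complete_pairs_in e 'I_m.+1 (@degenerate m).
  have card_right := card_complete_pairs_swap e_sym
    (fun p : {ffun 'I_m.+1 -> T} * {ffun 'I_m.+1 -> T} => degenerate p.2).
  rewrite card_ord -/B in card_left; rewrite /= card_left in card_right.
  rewrite -{1}card_left -card_right; apply: leq_trans (leq_card_setU _ _).
  apply: subset_leq_card; apply/subsetP => -[x y] xy.
  rewrite in_setU; apply/orP.
  by case/orP: (deg _ _ xy) => h; [left|right]; rewrite in_set; apply/andP.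
have BG : B <= s ^ m.+1 * #|T| ^ m.+1 + m.+1 * s * G by apply: sum_degenerate.
(* Counted from the other side, [G] runs over the same tuples as [H], with exponent one lower, so
   the two can be compared term by term. *)
have GE : G = \sum_(y : {ffun 'I_m.+1 -> T}) #|common_nbrs y| ^ m.
  have := card_complete_pairsC e_sym 'I_m 'I_m.+1.
  by rewrite !card_complete_pairs !card_ord.
have HE : H = \sum_(y : {ffun 'I_m.+1 -> T}) #|common_nbrs y| ^ m.+1.
  by rewrite /H card_complete_pairs card_ord.
have LG : L * G <= L ^ m.+1 * #|T| ^ m.+1 + H.
  have -> : L ^ m.+1 * #|T| ^ m.+1 = \sum_(y : {ffun 'I_m.+1 -> T}) L ^ m.+1.
    by rewrite sum_nat_const card_ffun card_ord mulnC.
  rewrite GE HE big_distrr -big_split; apply: leq_sum => y _ /=.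
  (* Rearrangement for [L] and the size of [common_nbrs y], with one of the two products
     discarded. *)
  by apply: leq_trans (leq_rearrangement_exp _ _ _); rewrite leq_addr.
have LGE : L * G = 4 * (m.+1 * s * G) by rewrite /L -!mulnA.
rewrite LGE in LG; rewrite -/L mulnDl -[4 * _ * _]mulnA.
move: (s ^ m.+1 * _) (L ^ m.+1 * _) (m.+1 * s * G) BG LG => p q r; lia.
Qed.

End NoBiclique.

Local Open Scope ring_scope.

(** * Graphs defined by orthogonality of vectors *)

Section BilinearGraph.

Variables (F : fieldType) (D : nat) (T : finType) (e : rel T).
Variables (u v : T -> 'rV[F]_D).
Hypothesis eE : forall x y, e x y = (u x *m (v y)^T == 0).

(** If row [i] were a combination of the others, a vector orthogonal to the others would be
    orthogonal to it too, making [i] redundant. *)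
Lemma row_free_not_redundant (m : nat) (x : {ffun 'I_m.+1 -> T}) :
  (forall i, ~~ redundant e x i) -> row_free (\matrix_i u (x i)).
Proof.
move=> nred; apply/idPn => /row_freePn[i]; apply/negP.
apply: contra (nred i) => /submxP[w Ew]; apply/subsetP => z /in_common_nbrs hz.
rewrite inE eE; rewrite rowK in Ew; rewrite Ew -mulmxA.
suff -> : row' i (\matrix_i0 u (x i0)) *m (v z)^T = 0 by rewrite mulmx0.
apply/row_matrixP => j; rewrite row0 row_mul.
have := hz j; rewrite ffunE eE => /eqP <-; congr (_ *m _).
by apply/rowP => c; rewrite !mxE.
Qed.

End BilinearGraph.

(** The orthogonal of [Y] has dimension [D - k <= k] and contains the [k]-dimensional row space of
    [X], so they coincide. Hence [a] is a combination of the rows of [X], all orthogonal to [b]. *)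
Lemma orthogonal_saturation (F : fieldType) (k D : nat) (X Y : 'M[F]_(k, D))
    (a b : 'rV[F]_D) :
  (D <= k + k)%N -> row_free X -> row_free Y -> X *m Y^T = 0 ->
  a *m Y^T = 0 -> X *m b^T = 0 -> a *m b^T = 0.
Proof.
move=> leD /eqP rX /eqP rY XY aY Xb.
have XK : (X <= kermx Y^T)%MS by apply/sub_kermxP.
have aK : (a <= kermx Y^T)%MS by apply/sub_kermxP.
have KX : (kermx Y^T <= X)%MS.
  by rewrite -(geq_leqif (mxrank_leqif_sup XK)) mxrank_ker mxrank_tr rX rY; lia.
by have /submxP[w ->] := submx_trans aK KX; rewrite -mulmxA Xb mulmx0.
Qed.

Lemma bilinear_degenerate (F : fieldType) (D m s : nat) (T : finType) (e : rel T)
    (u v : T -> 'rV[F]_D) (x y : {ffun 'I_m.+1 -> T}) :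
  (forall x y, e x y = (u x *m (v y)^T == 0)) ->
  symmetric e -> irreflexive e -> ~ contains_biclique e s s ->
  (D <= m.+1 + m.+1)%N -> (x, y) \in complete_pairs e 'I_m.+1 'I_m.+1 ->
  degenerate e s x || degenerate e s y.
Proof.
move=> eE e_sym e_irr nob leD xy; apply: contraT; rewrite !negb_or -!leqNgt.
move=> /andP[/andP[sx /existsPn nx] /andP[sy /existsPn ny]].
(* Symmetry of [e] exchanges the roles of [u] and [v], so freeness of [y] is obtained for the
   vectors [v]. *)
have eE' a b : e a b = (v a *m (u b)^T == 0).
  by rewrite e_sym eE -trmx_eq0 trmx_mul trmxK.
have fX := row_free_not_redundant eE nx.
have fY := row_free_not_redundant eE' ny.
have mulX b : b \in common_nbrs e x -> (\matrix_i u (x i)) *m (v b)^T = 0.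
  move=> /in_common_nbrs hb; apply/row_matrixP => i; rewrite row0 row_mul rowK.
  by apply/eqP; rewrite -eE.
have mulY a : a \in common_nbrs e y -> u a *m (\matrix_i v (y i))^T = 0.
  move=> /in_common_nbrs ha; apply: trmx_inj; rewrite trmx_mul trmxK trmx0.
  by apply/row_matrixP => i; rewrite row0 row_mul rowK; apply/eqP; rewrite -eE'.
have XY : (\matrix_i u (x i)) *m (\matrix_i v (y i))^T = 0.
  apply/row_matrixP => i; rewrite row0 row_mul rowK; apply: mulY.
  by apply/in_common_nbrs => j; rewrite e_sym; move/in_complete_pairs: xy.
have := @complete_sets_small _ _ _ e_irr nob (common_nbrs e y) (common_nbrs e x).
rewrite [(_ < _)%N]ltnNge sx; apply => // a b ya xb.
rewrite eE; apply/eqP/(orthogonal_saturation leD fX fY XY).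
  exact: mulY.
exact: mulX.
Qed.

(** * Unit distance as orthogonality in dimension d + 2 *)

Definition sphere_normal (F : fieldType) (d : nat) (x : 'rV[F]_d) :
    'rV[F]_(1 + 1 + d) :=
  row_mx (row_mx 1 (\sum_i x 0 i ^+ 2 - 1)%:M) (- (x *+ 2)).

(** The product with [sphere_normal x] is |y|^2 + (|x|^2 - 1) - 2<x, y> = |y - x|^2 - 1: unit
    spheres become hyperplane sections of a paraboloid. *)
Definition paraboloid_lift (F : fieldType) (d : nat) (y : 'rV[F]_d) :
    'rV[F]_(1 + 1 + d) :=
  row_mx (row_mx (\sum_i y 0 i ^+ 2)%:M 1) y.

Lemma unit_distE (F : fieldType) (d : nat) (x y : 'rV[F]_d) :
  unit_dist x y = (sphere_normal x *m (paraboloid_lift y)^T == 0).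
Proof.
rewrite /unit_dist /= inE -subr_eq0 /sphere_normal /paraboloid_lift.
rewrite !tr_row_mx !mul_row_col mul1mx trmx1 mulmx1 tr_scalar_mx.
set q := (X in _ = (X == 0)).
suff -> : \sum_(i < d) (y 0 i - x 0 i) ^+ 2 - 1 = q 0 0.
  apply/eqP/eqP => [h|->]; last by rewrite mxE.
  by apply/matrixP => i j; rewrite !ord1 h mxE.
rewrite /q !mxE /= addrA addrAC; congr (_ - 1); rewrite -!big_split /=.
apply: eq_bigr => i _; rewrite !mxE -mulr2n sqrrB mulNr mulrnAl.
by rewrite [x 0 i * _]mulrC addrAC.
Qed.

Lemma unit_dist_sym (F : fieldType) (d : nat) : symmetric (@unit_dist F d).
Proof.
move=> x y; rewrite /unit_dist /= !inE; congr (_ == _).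
by apply: eq_bigr => i _; rewrite -opprB sqrrN.
Qed.

Lemma unit_dist_irr (F : fieldType) (d : nat) : irreflexive (@unit_dist F d).
Proof.
move=> x; rewrite /unit_dist /= inE big1 ?(eq_sym 0) ?oner_eq0 // => i _.
by rewrite subrr expr0n.
Qed.

Lemma card_edges_leq (T : finType) (e : rel T) :
  (#|edges e| <= \sum_(y : T) #|[set z | e y z]|)%N.
Proof.
apply: leq_trans (leq_imset_card _ _) _.
rewrite -sum1_card (eq_bigl (fun p : T * T => xpredT p.1 && e p.1 p.2)); last first.
  by move=> p; rewrite inE.
rewrite -(pair_big_dep xpredT e (fun _ _ => 1%N)) /=.
apply: leq_sum => y _; rewrite -sum1_card.
by apply: eq_leq; apply: eq_bigl => z; rewrite inE.
Qed.

(** * The bound in integers, then with real exponents *)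

Lemma num_unit_distances_exp_leq (F : fieldType) (d s : nat) (P : {fset 'rV[F]_d})
    (m := uphalf d) :
  ~ contains_biclique (unit_distance_graph P) s s ->
  (num_unit_distances P ^ (m.+1 * m.+1)
    <= (4 * s ^ m.+1 + (4 * m.+1 * s) ^ m.+1) * #|` P|%fset ^ (m.+1 * (2 * m + 1)))%N.
Proof.
move=> nob; set e := unit_distance_graph P in nob *.
have e_sym : symmetric e by move=> x y; apply: unit_dist_sym.
have e_irr : irreflexive e by move=> x; apply: unit_dist_irr.
have leD : (1 + 1 + d <= m.+1 + m.+1)%N by rewrite /m; lia.
have eE (x y : P) : e x y = (sphere_normal (val x) *m (paraboloid_lift (val y))^T == 0).
  exact: unit_distE.
have Hle := card_complete_pairs_degenerate e_sym e_irr nob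
  (fun x y => bilinear_degenerate eE e_sym e_irr nob leD).
apply: (@leq_trans ((\sum_(y : P) #|[set z | e y z]|) ^ (m.+1 * m.+1))).
  by rewrite leq_exp2r // card_edges_leq.
apply: leq_trans (leq_card_complete_pairs e_sym m) _.
rewrite cardfE; apply: leq_trans (leq_mul (leqnn _) Hle) _.
(* The exponents of the number of points add up: 2(m+1)m + (m+1) = (m+1)(2m+1). *)
by rewrite mulnCA -expnD; apply: eq_leq; congr (_ * _ ^ _)%N; lia.
Qed.

(* uphalf d is the ceiling of d / 2 *)
Theorem theorem1p4 (R : realType) (d s : nat) (hd : (0 < d)%N) (hs : (0 < s)%N) :
  exists C : R, 0 < C /\
    forall (F : fieldType) (n : nat) (P : {fset 'rV[F]_d}),
      #|` P|%fset = n ->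
      ~ contains_biclique (unit_distance_graph P) s s ->
      (num_unit_distances P)%:R <=
        C * (n%:R `^ (2 - 1 / ((uphalf d).+1)%:R)).
Proof.
set m := uphalf d; pose C0 := (4 * s ^ m.+1 + (4 * m.+1 * s) ^ m.+1)%N.
have C0_gt0 : (0 < C0)%N by rewrite addn_gt0 muln_gt0 expn_gt0 hs.
exists C0%:R; split=> [|F n P Pn nob]; first by rewrite ltr0n.
have := num_unit_distances_exp_leq nob; rewrite -/m -/C0 Pn => hN.
(* Both sides are raised to the power (m+1)^2 to reach the integer inequality. *)
rewrite -(@ler_pXn2r _ (m.+1 * m.+1)) ?nnegrE ?mulr_ge0 ?powR_ge0 ?ler0n //.
rewrite -natrX; apply: (@le_trans _ _ (C0 * n ^ (m.+1 * (2 * m + 1)))%:R).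
  by rewrite ler_nat.
rewrite natrM exprMn; apply: ler_pM; rewrite ?ler0n //.
  (* Since [C0] is at least 1, it is at most its own power, so [C0] serves as the constant without
     taking a root. *)
  by rewrite -natrX ler_nat -{1}[C0]expn1 leq_pexp2l.
rewrite -powR_mulrn ?powR_ge0 // -powRrM natrX -powR_mulrn ?ler0n //.
suff -> : (2 - 1 / m.+1%:R) * (m.+1 * m.+1)%:R = (m.+1 * (2 * m + 1))%:R :> R by [].
rewrite !natrM mulrA mulrBl mul1r mulVf ?pnatr_eq0 // mulrC; congr (_ * _).
by rewrite natrD natrM -(natr1 m) mulrDr mulr1 -addrA; congr (_ + _); rewrite addrK.
Qed.
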